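(* Let $k\geq 16$ be a positive integer. Let $A$ be a finite set of $k$ integers such that $\min(A)=0$, $\gcd(A)=1$, and $|4^{\wedge}A| = 4k-12$. Then $A=[0,k+2]\setminus\{x,y,z\}$, where $\{x,y,z\}$ is one of the sets $\{1,2,3\}$, $\{k-1,k,k+1\}$, $\{1,2,k+1\}$, $\{1,k,k+1\}$, $\{1,3,k+2\}$, $\{k-2,k,k+2\}$, $\{2,k,k+2\}$, $\{1,k-1,k+2\}$, $\{3,k+1,k+2\}$, $\{k-3,k+1,k+2\}$, $\{4,k+1,k+2\}$, $\{k-4,k+1,k+2\}$.
   Context: For a finite set $A$ of integers and a positive integer $h\le |A|$, the restricted $h$-fold sumset $h^{\wedge}A$ is the set of all sums of $h$ distinct elements of $A$. For integers $\alpha\le\beta$, $[\alpha,\beta]=\{x\in\mathbb{Z}:\alpha\le x\le\beta\}$. $\gcd(A)$ denotes the greatest common divisor of the elements of $A$. *)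

(* Defs.v *)
From HB Require Import structures.
From mathcomp Require Import all_boot all_order all_algebra.
From mathcomp Require Import finmap.

Set Implicit Arguments.
Unset Strict Implicit.
Unset Printing Implicit Defensive.

Import Order.TTheory GRing.Theory Num.Theory.
Local Open Scope fset_scope.
Local Open Scope ring_scope.

Definition restricted_sumset (h : nat) (A : {fset int}) : {fset int} :=
  [fset \sum_(x <- B) x | B : {fset int} in [fset C in fpowerset A | #|` C| == h]].

Lemma restricted_sumsetP (h : nat) (A : {fset int}) (s : int) :
  reflect (exists B : {fset int},
             [/\ B `<=` A, #|` B| = h & s = \sum_(x <- B) x])
          (s \in restricted_sumset h A).
Proof.
apply: (iffP (imfsetP _ _ _ _)) => [[B] | [B [sBA cB ->]]].
  by rewrite /= !inE /= fpowersetE => /andP[sBA /eqP cB] ->; exists B.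
by exists B => //; rewrite /= !inE /= fpowersetE sBA cB eqxx.
Qed.

Definition int_interval (a b : int) : {fset int} :=
  if a <= b then [fset a + i%:Z | i in iota 0 (absz (b - a)).+1] else fset0.

Lemma in_int_interval (a b x : int) :
  (x \in int_interval a b) = (a <= x <= b).
Proof.
rewrite /int_interval; case: ifP => [le_ab | nle_ab]; last first.
  rewrite inE; apply/esym/negP => /andP[le_ax le_xb].
  by rewrite (le_trans le_ax le_xb) in nle_ab.
have abs_ge0 (c : int) : a <= c -> (absz (c - a))%:Z = c - a.
  by move=> le_ac; rewrite abszE ger0_norm ?subr_ge0.
apply/imfsetP/idP => [[i i_in ->] | /andP[le_ax le_xb]].
  have : (i \in iota 0 (absz (b - a)).+1) by [].
  rewrite mem_iota leq0n add0n ltnS -lez_nat abs_ge0 // lerBrDl => le_ib.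
  by rewrite lerDl le_ib.
exists (absz (x - a)); last by rewrite /= abs_ge0 // subrKC.
suff : (absz (x - a) \in iota 0 (absz (b - a)).+1) by [].
by rewrite mem_iota leq0n add0n ltnS -lez_nat (abs_ge0 _ le_ax) abs_ge0 ?lerD2r.
Qed.

Definition is_fset_min (A : {fset int}) (m : int) : Prop :=
  m \in A /\ forall a : int, a \in A -> m <= a.

Definition fset_gcd (A : {fset int}) : int := \big[gcdz/0]_(a <- A) a.

(* Main.v *)
(* Call the excess of a finite set B the difference between |4^B| and its minimum
   4|B| - 15. Two blocks of consecutive elements of A overlapping in four elements
   have exactly one common 4-sum, so the excess is superadditive along such blocks;
   in particular each block of A has excess at most 3. Among the four 7-element
   blocks, with overlaps of 4, of a 16-element block, one has excess 0, hence
   starts with a 6-term progression. Its difference d divides every gap, since an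
   element outside the residue class creates too many new sums; so d = 1. Growing
   this progression one element at a time while the excess stays at most 3 leaves
   finitely many gap words of length 15, and these force all gaps of A to be 1 except
   for a few near the two ends. Superadditivity and the bound max - min + 1 on the
   number of sums then select the twelve sets. *)
Require Import Defs.
From mathcomp Require Import all_boot all_order all_algebra.
From mathcomp Require Import finmap.
From mathcomp Require Import zify.
Import Order.TTheory GRing.Theory Num.Theory.

Set Implicit Arguments.
Unset Strict Implicit.

(** * Sums over subsequences and their computation *)

Fixpoint ksums (h : nat) (s : seq nat) : seq nat :=
  match s with
  | [::] => if h is 0 then [:: 0] else [::]
  | x :: s' =>
    (if h is h'.+1 then [seq x + y | y <- ksums h' s'] else [::]) ++ ksums h s'
  end.

Lemma ksumsP h s x :
  reflect (exists t, [/\ subseq t s, size t = h & sumn t = x])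
          (x \in ksums h s).
Proof.
apply: (iffP idP) => [|[t []]].
  elim: s h x => [|a s IH] [|h] x //=.
  - by rewrite inE => /eqP->; exists [::].
  - by move=> /IH[t [ts <- <-]]; exists t; split=> //;
      exact: subseq_trans ts (subseq_cons _ _).
  rewrite mem_cat => /orP[/mapP[y /IH[t [ts <- <-]] ->]|/IH[t [ts <- <-]]].
    by exists (a :: t); rewrite /= eqxx.
  by exists t; split=> //; exact: subseq_trans ts (subseq_cons _ _).
elim: s h x t => [|a s IH] h x t.
  by rewrite subseq0 => /eqP-> <- <-; rewrite inE.
case: t => [_ <- <-|b t] /=; first by apply: (IH _ _ [::]); rewrite ?sub0seq.
case: eqP => [->|_] ts <- <- /=; rewrite mem_cat.
  by rewrite (map_f (addn a)) //; apply: IH ts _ _.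
by rewrite orbC (IH _ _ (b :: t)).
Qed.

Lemma ksums_subseq h s1 s2 : subseq s1 s2 -> {subset ksums h s1 <= ksums h s2}.
Proof.
move=> s12 x /ksumsP[t [ts1 <- <-]]; apply/ksumsP; exists t; split=> //.
exact: subseq_trans ts1 s12.
Qed.

Lemma mem_ksums_rcons h s m x : x \in ksums h s -> m + x \in ksums h.+1 (rcons s m).
Proof.
move=> /ksumsP[t [ts <- <-]]; apply/ksumsP; exists (rcons t m).
by rewrite size_rcons sumn_rcons addnC -!cats1 cat_subseq.
Qed.

Lemma ksums_affine h c d s :
  ksums h [seq c + d * y | y <- s] = [seq h * c + d * y | y <- ksums h s].
Proof.
elim: s h => [|a s IH] [|h] //=; first by rewrite muln0.
rewrite map_cat !IH -!map_comp; congr (_ ++ _); apply: eq_map => y /=; lia.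
Qed.

Lemma ksums_shift h c s :
  ksums h [seq c + y | y <- s] = [seq h * c + y | y <- ksums h s].
Proof.
have E k (l : seq nat) : [seq k + y | y <- l] = [seq k + 1 * y | y <- l].
  by apply: eq_map => y; rewrite mul1n.
by rewrite !E ksums_affine.
Qed.

Definition nsums h s := size (undup (ksums h s)).

Lemma leq_nsums h s l : uniq l -> {subset l <= ksums h s} -> size l <= nsums h s.
Proof. by move=> ul sl; apply: uniq_leq_size => // x /sl; rewrite mem_undup. Qed.

Fixpoint orv (a b : bitseq) : bitseq :=
  match a, b with
  | [::], _ => b
  | _, [::] => a
  | x :: a', y :: b' => (x || y) :: orv a' b'
  end.

Lemma nth_orv a b i : nth false (orv a b) i = nth false a i || nth false b i.
Proof.
by elim: a b i => [|x a IH] [|y b] [|i] //=; rewrite ?nth_nil ?orbF.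
Qed.

(* Characteristic vector of [ksums h s], for evaluation by the kernel. *)
Fixpoint bsums (h : nat) (s : seq nat) : bitseq :=
  match s with
  | [::] => if h is 0 then [:: true] else [::]
  | x :: s' =>
    orv (if h is h'.+1 then nseq x false ++ bsums h' s' else [::]) (bsums h s')
  end.

Lemma nth_bsums h s i : nth false (bsums h s) i = (i \in ksums h s).
Proof.
elim: s h i => [|a s IH] [|h] i /=; rewrite ?inE ?nth_nil //.
- by case: i => [|[]].
rewrite nth_orv mem_cat IH; congr (_ || _).
rewrite nth_cat size_nseq nth_nseq if_same.
case: ltnP => [lt_ia|le_ai].
  by apply/esym/negP => /mapP[y _]; lia.
rewrite IH; apply/idP/mapP => [iK|[y yK ->]]; last by rewrite addKn.
by exists (i - a) => //; rewrite subnKC.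
Qed.

Lemma ltn_size_bsums h s x : x \in ksums h s -> x < size (bsums h s).
Proof.
by rewrite -nth_bsums; apply: contraTT; rewrite -leqNgt => /(nth_default _)->.
Qed.

Lemma count_drop_bsums k h s :
  size [seq x <- undup (ksums h s) | k <= x] = count id (drop k (bsums h s)).
Proof.
set b := drop k _.
have -> : count id b = size [seq k + i | i <- iota 0 (size b) & nth false b i].
  rewrite size_map size_filter -[in LHS](mkseq_nth false b) /mkseq count_map.
  exact: eq_count.
apply/perm_size/uniq_perm.
- by rewrite filter_uniq ?undup_uniq.
- by rewrite map_inj_uniq ?filter_uniq ?iota_uniq //; apply: addnI.
move=> x; rewrite mem_filter mem_undup; apply/andP/mapP => [[kx xs]|[i]].
  exists (x - k); rewrite ?subnKC // mem_filter /b nth_drop subnKC // nth_bsums xs.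
  by have := ltn_size_bsums xs; rewrite mem_iota size_drop; lia.
by rewrite mem_filter /b nth_drop nth_bsums => /andP[iK _] ->; rewrite leq_addr.
Qed.

Lemma nsumsE h s : nsums h s = count id (bsums h s).
Proof.
rewrite -[bsums h s]drop0 -count_drop_bsums /nsums; congr size.
by rewrite (eq_filter (a2 := predT)) ?filter_predT.
Qed.

(** * Gap words and their points *)

(* A finite set of naturals containing 0 is encoded by the word of gaps between
   consecutive elements; [pts w] recovers the set. *)
Fixpoint pts (w : seq nat) : seq nat :=
  if w is g :: w' then 0 :: [seq g + x | x <- pts w'] else [:: 0].

Definition nsums4 w := nsums 4 (pts w).

Local Notation pos := (all (leq 1)).

Lemma size_pts w : size (pts w) = (size w).+1.
Proof. by elim: w => //= g w IH; rewrite size_map IH. Qed.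

Lemma pts_consE w : pts w = 0 :: behead (pts w).
Proof. by case: w. Qed.

Lemma take_pts u v : take (size u).+1 (pts (u ++ v)) = pts u.
Proof.
elim: u => [|g u IH] /=; first by rewrite pts_consE /= take0.
by rewrite -map_take IH.
Qed.

Lemma drop_pts u v : drop (size u) (pts (u ++ v)) = [seq sumn u + x | x <- pts v].
Proof.
elim: u => [|g u IH] /=; first by rewrite drop0 map_id.
by rewrite -map_drop IH -map_comp; apply: eq_map => x /=; rewrite addnA.
Qed.

Lemma pts_rcons w g : pts (rcons w g) = rcons (pts w) (sumn w + g).
Proof.
elim: w => [|a w IH] /=; first by rewrite addn0.
by rewrite IH map_rcons addnA.
Qed.

Lemma sorted_pts w : pos w -> sorted ltn (pts w).
Proof.
elim: w => //= g w IH /andP[g0 /IH]; rewrite (pts_consE w) /= addn0 g0 /= => pw.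
rewrite -[X in path _ X _]addn0 path_map; apply: sub_path pw => x y.
by rewrite /= ltn_add2l.
Qed.

(** * Extreme sums and superadditivity along overlapping blocks *)

Lemma sumn_take_leq s t :
  sorted ltn s -> subseq t s -> sumn (take (size t) s) <= sumn t.
Proof.
elim: s t => [|a s IH] t; first by rewrite subseq0 => _ /eqP->.
move=> as_; have ss := path_sorted as_.
case: t => [|b t] //=; case: eqP => [->|_] ts; first by rewrite leq_add2l IH.
(* The head [a] is skipped here. Compared with equally many first entries of the tail, those of
   [a :: s] trade the last one for the smaller [a]. *)
apply: leq_trans (IH _ ss ts).
have lt_ts := size_subseq ts.
rewrite [size (b :: t)]/= (take_nth 0) // sumn_rcons addnC leq_add2l.
have /allP := order_path_min ltn_trans as_.
by move=> /(_ _ (mem_nth 0 lt_ts))/ltnW.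
Qed.

Lemma sumn_drop_geq s t :
  sorted ltn s -> subseq t s -> sumn t <= sumn (drop (size s - size t) s).
Proof.
elim: s t => [|a s IH] t; first by rewrite subseq0 => _ /eqP->.
move=> as_; have ss := path_sorted as_.
have skip u : subseq u s -> sumn u <= sumn (drop (size (a :: s) - size u) (a :: s)).
  by move=> us; rewrite [size (a :: s)]/= subSn ?size_subseq //=; apply: IH.
case: t => [|b t] //=; case: eqP => [->|_] ts; last exact: (skip (b :: t) ts).
have le_ts := size_subseq ts; have := IH _ ss ts; rewrite subSS.
case E: (size s - size t) => [|m] le_t /=; first by rewrite leq_add2l -(drop0 s).
have lt_ms : m < size s by lia.
rewrite (drop_nth 0) //= leq_add //.
have /allP := order_path_min ltn_trans as_.
by move=> /(_ _ (mem_nth 0 lt_ms))/ltnW.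
Qed.

Lemma ksums_min h s x : sorted ltn s -> x \in ksums h s -> sumn (take h s) <= x.
Proof. by move=> ss /ksumsP[t [ts <- <-]]; apply: sumn_take_leq. Qed.

Lemma ksums_max h s x :
  sorted ltn s -> x \in ksums h s -> x <= sumn (drop (size s - h) s).
Proof. by move=> ss /ksumsP[t [ts <- <-]]; apply: sumn_drop_geq. Qed.

Lemma sumn_shift c s : sumn [seq c + x | x <- s] = size s * c + sumn s.
Proof. by elim: s => //= a s ->; lia. Qed.

(* The largest 4-sum of the points of [u ++ v] is the smallest 4-sum of those of
   [v ++ z], and it is their only common 4-sum. *)
Lemma nsums4_glue u v z : pos (u ++ v ++ z) -> size v = 3 ->
  nsums4 (u ++ v) + nsums4 (v ++ z) <= (nsums4 (u ++ v ++ z)).+1.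
Proof.
move=> pw v3; have := pw; rewrite !all_cat => /and3P[pu pv pz].
pose M := 4 * sumn u + sumn (pts v).
pose X := undup (ksums 4 (pts (u ++ v))).
pose Y := [seq 4 * sumn u + x | x <- undup (ksums 4 (pts (v ++ z)))].
have XM x : x \in X -> x <= M.
  rewrite mem_undup => /ksums_max; rewrite size_pts size_cat v3 addn3 subSS.
  rewrite -addn3 addnK drop_pts sumn_shift size_pts v3; apply.
  by apply: sorted_pts; rewrite all_cat pu.
have MY y : y \in Y -> M <= y.
  move=> /mapP[x]; rewrite mem_undup => /ksums_min xm ->; rewrite leq_add2l.
  by have := take_pts v z; rewrite v3 => <-; apply: xm; apply: sorted_pts;
    rewrite all_cat pv.
have uY : uniq Y by rewrite map_inj_uniq ?undup_uniq //; apply: addnI.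
have szY : size Y = nsums4 (v ++ z) by rewrite size_map.
have := @leq_nsums 4 (pts (u ++ v ++ z)) (X ++ [seq y <- Y | y != M]).
rewrite size_cat -/(nsums4 (u ++ v ++ z)) => H.
have : size X + size [seq y <- Y | y != M] <= nsums4 (u ++ v ++ z).
  apply: H.
    rewrite cat_uniq undup_uniq filter_uniq // andbT /=; apply/hasPn => y.
    rewrite mem_filter => /andP[nyM /MY le_My]; apply/negP => /XM le_yM.
    by move/negP: nyM; apply; rewrite eqn_leq le_My le_yM.
  move=> x; rewrite mem_cat mem_undup mem_filter => /orP[|/andP[_ /mapP[y]]].
    by apply: ksums_subseq; rewrite -(take_pts (u ++ v) z) -catA take_subseq.
  rewrite mem_undup => yK ->.
  have: 4 * sumn u + y \in ksums 4 [seq sumn u + x | x <- pts (v ++ z)].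
    by rewrite ksums_shift; apply: map_f.
  by apply: ksums_subseq; rewrite -drop_pts drop_subseq.
have := count_predC (pred1 M) Y; rewrite size_filter szY.
rewrite (count_uniq_mem _ uY) (eq_count (a2 := fun y => y != M)) //.
by rewrite /X -/(nsums 4 _) -/(nsums4 _); case: (M \in Y); lia.
Qed.

(** Each new gap adds at least four sums: the last five points have five 4-sums, and only one of
    them is shared with the earlier block. *)
Lemma nsums4_lower w : pos w -> 3 <= size w -> 4 * size w <= nsums4 w + 11.
Proof.
elim/last_ind: w => // w g IH pw; rewrite size_rcons => le3.
have [lt3|{le3}le3] := ltnP (size w) 3.
  suff: 1 <= nsums4 (rcons w g) by lia.
  apply: (@leq_nsums _ _ [:: sumn (pts (rcons w g))]) => // x; rewrite inE => /eqP->.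
  by apply/ksumsP; exists (pts (rcons w g)); rewrite size_pts size_rcons; split=> //; lia.
have {}IH : 4 * size w <= nsums4 w + 11 by apply: IH => //; move: pw; rewrite all_rcons => /andP[].
have N4 a b c d : pos [:: a; b; c; d] -> 5 <= nsums4 [:: a; b; c; d].
  move=> p4.
  (* The 4-sums of five points, each leaving out one point, from the largest point down to 0. *)
  apply: (@leq_nsums _ _ [:: 3*a+2*b+c; 3*a+2*b+c+d; 3*a+2*b+2*c+d; 3*a+3*b+2*c+d; 4*a+3*b+2*c+d]).
    by apply: (sorted_uniq ltn_trans ltnn); move: p4 => /=; lia.
  by move=> x; rewrite /= !inE; lia.
have s3 : size (drop (size w - 3) w) = 3 by rewrite size_drop; lia.
have := @nsums4_glue (take (size w - 3) w) _ [:: g] _ s3.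
rewrite catA cat_take_drop cats1 => /(_ pw).
have : pos (drop (size w - 3) w ++ [:: g]).
  by move: pw; rewrite -{1}(cat_take_drop (size w - 3) w) -cats1 -catA all_cat => /andP[].
case: (drop _ _) s3 => [|a [|b [|c []]]] //= _ p4; have := N4 _ _ _ _ p4; lia.
Qed.

(** Reflecting the points sends a 4-sum [x] to [4 * sumn w - x], which is injective because no 4-sum
    exceeds [4 * sumn w]. One inequality suffices, since [rev] is an involution. *)
Lemma nsums4_rev w : nsums4 (rev w) = nsums4 w.
Proof.
have ptsR u : pts (rev u) = rev [seq sumn u - x | x <- pts u].
  elim: u => //= g u IH; rewrite rev_cons pts_rcons IH sumn_rev rev_cons subn0 addnC.
  congr (rcons (rev _) _); rewrite -map_comp; apply: eq_map => x /=; lia.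
have le_pts u x : x \in pts u -> x <= sumn u.
  elim: u x => [|g u IH] x /=; first by rewrite inE => /eqP->.
  rewrite inE => /orP[/eqP->//|/mapP[y /IH le_y ->]].
  by rewrite leq_add2l.
suff le u : nsums4 u <= nsums4 (rev u) by apply/eqP; rewrite eqn_leq le -{2}[w]revK le.
have le4 x : x \in ksums 4 (pts u) -> x <= 4 * sumn u /\ 4 * sumn u - x \in ksums 4 (pts (rev u)).
  case/ksumsP=> t [ts t4 <-].
  have : all (fun x => x <= sumn u) t by apply/allP => y /(mem_subseq ts)/le_pts.
  move: ts; rewrite ptsR; case: t t4 => [|a [|b [|c [|d []]]]] // _ ts /= le_t.
  split; first lia.
  apply/ksumsP; exists (rev [seq sumn u - x | x <- [:: a; b; c; d]]).
  by rewrite subseq_rev map_subseq ?size_rev // sumn_rev /=; split=> //; lia.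
have := @leq_nsums 4 (pts (rev u)) [seq 4 * sumn u - x | x <- undup (ksums 4 (pts u))].
rewrite size_map; apply.
  rewrite map_inj_in_uniq ?undup_uniq // => x y; rewrite !mem_undup.
  by move=> /le4[? _] /le4[? _]; lia.
by move=> y /mapP[x]; rewrite mem_undup => /le4[_ ?] ->.
Qed.

(** * Words of excess at most three *)

(* The set has at most three 4-sums more than the minimum [4 * size w - 11]. *)
Definition tight w := nsums4 w + 8 <= 4 * size w.

(** The last three gaps of [v] followed by [z] form a block of nonnegative excess, so by
    superadditivity the excess of [v] is at most that of [v ++ z]. *)
Lemma tight_prefix v z : pos (v ++ z) -> 3 <= size v -> tight (v ++ z) -> tight v.
Proof.
rewrite /tight => pw le3; have s3 : size (drop (size v - 3) v) = 3.
  by rewrite size_drop; lia.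
have := @nsums4_glue (take (size v - 3) v) _ z _ s3.
rewrite catA cat_take_drop => /(_ pw).
have := @nsums4_lower (drop (size v - 3) v ++ z); rewrite !size_cat s3 leq_addr.
have -> : pos (drop (size v - 3) v ++ z).
  by move: pw; rewrite -{1}(cat_take_drop (size v - 3) v) -catA all_cat => /andP[].
by move=> /(_ isT isT); lia.
Qed.

Lemma tight_rev w : tight (rev w) = tight w.
Proof. by rewrite /tight nsums4_rev size_rev. Qed.

Lemma tight_suffix u v : pos (u ++ v) -> 3 <= size v -> tight (u ++ v) -> tight v.
Proof.
move=> pw le3; rewrite -tight_rev rev_cat => /tight_prefix tw.
by rewrite -tight_rev; apply: tw; rewrite ?size_rev // -rev_cat all_rev.
Qed.

(** * Few sums force an arithmetic progression *)

Lemma eq_sorted_ksums h s l1 l2 : sorted ltn l1 -> sorted ltn l2 ->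
  {subset l1 <= ksums h s} -> {subset l2 <= ksums h s} ->
  nsums h s <= size l1 -> size l1 = size l2 -> l1 = l2.
Proof.
move=> s1 s2 l1s l2s le1 e12; apply: (irr_sorted_eq ltn_trans ltnn) => // x.
have full l : sorted ltn l -> {subset l <= ksums h s} -> nsums h s <= size l ->
    l =i ksums h s.
  move=> sl ls lel y; rewrite -[RHS]mem_undup.
  (* A duplicate-free list of sums at least as long as the number of sums contains all of them; its
     increasing order is then unique. *)
  have [] // := uniq_min_size (sorted_uniq ltn_trans ltnn sl) _ lel.
  by move=> z /ls; rewrite mem_undup.
by rewrite !full -?e12.
Qed.

Ltac find_sum :=
  first [ by apply/eqP; lia
        | apply/orP; first [by left; apply/eqP; lia | right; find_sum] ].

(* Two maximal chains of 4-subsets of a 6-set give the same nine sums. *)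
Lemma six_points_progression a b c d e :
  pos [:: a; b; c; d; e] -> nsums4 [:: a; b; c; d; e] <= 9 ->
  [:: a; b; c; d; e] = nseq 5 a.
Proof.
move=> pw le9; pose x1 := a; pose x2 := a + b; pose x3 := x2 + c.
pose x4 := x3 + d; pose x5 := x4 + e.
(* A triple stands for its 4-sum with the point 0. Equating the third to seventh entries gives
   [x3 = x1 + x2], [x4 = x1 + x3], [x5 = x2 + x3] and finally [x2 = 2 * x1]. *)
have [] : [:: x1+x2+x3; x1+x2+x4; x1+x2+x5; x1+x3+x5; x1+x4+x5; x2+x4+x5;
              x3+x4+x5; x1+x3+x4+x5; x2+x3+x4+x5] =
          [:: x1+x2+x3; x1+x2+x4; x1+x3+x4; x2+x3+x4; x1+x2+x3+x4; x1+x2+x3+x5;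
              x1+x2+x4+x5; x1+x3+x4+x5; x2+x3+x4+x5].
  { apply: (@eq_sorted_ksums 4 (pts [:: a; b; c; d; e])) => //;
    [move: pw | move: pw | apply/allP | apply/allP]; rewrite /= /x5 /x4 /x3 /x2 /x1.
  - by lia.
  - by lia.
  - by rewrite !inE; do !(apply/andP; split); by [| find_sum].
  - by rewrite !inE; do !(apply/andP; split); by [| find_sum]. }
move: pw; rewrite /= /x5 /x4 /x3 /x2 /x1 => pw *; do !congr (_ :: _); lia.
Qed.

(** The last five points have at least 5 sums, which by gluing leaves at most 13 + 1 - 5 = 9 for the
    first six points. *)
Lemma seven_points_progression a b c d e f :
  pos [:: a; b; c; d; e; f] -> nsums4 [:: a; b; c; d; e; f] <= 13 ->
  [:: a; b; c; d; e] = nseq 5 a.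
Proof.
move=> pw le13; have p5 : pos [:: a; b; c; d; e] by move: pw => /=; lia.
have p4 : pos [:: c; d; e; f] by move: pw => /=; lia.
apply: six_points_progression => //.
have := @nsums4_glue [:: a; b] [:: c; d; e] [:: f] pw erefl; rewrite /=.
by have := nsums4_lower p4 isT; rewrite /=; lia.
Qed.

(** * Divisibility of all gaps by the difference of a progression *)

Lemma dvdn_pts d w : all (dvdn d) w -> all (dvdn d) (pts w).
Proof.
elim: w => [|g w IH] /=; rewrite dvdn0 // => /andP[dg /IH dw]; rewrite all_map /=.
by apply: sub_all dw => x dx; rewrite /= dvdn_add.
Qed.

Lemma dvdn_ksums d h s x : all (dvdn d) s -> x \in ksums h s -> d %| x.
Proof.
move=> /allP ds /ksumsP[t [/mem_subseq ts _ <-]].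
have : all (dvdn d) t by apply/allP => y /ts/ds.
by elim: t {ts} => //= a t IH /andP[da /IH dt]; rewrite dvdn_add.
Qed.

Lemma pts_nseq n d : pts (nseq n d) = [seq d * i | i <- iota 0 n.+1].
Proof.
elim: n => [|n IH]; first by rewrite /= muln0.
rewrite [pts _]/= IH -[iota 0 n.+2]/(0 :: iota (1 + 0) n.+1) iotaDl map_cons muln0.
by rewrite -!map_comp; congr (_ :: _); apply: eq_map => i /=; rewrite mulnDr muln1.
Qed.

(* Otherwise adding the new point creates ten new 4-sums, its sums with the
   3-sums of the progression. *)
Lemma tight_gap_dvdn d v g :
  pos (nseq 5 d ++ rcons v g) -> all (dvdn d) v -> tight (nseq 5 d ++ rcons v g) -> d %| g.
Proof.
move=> pw dv; rewrite /tight -rcons_cat; set w := nseq 5 d ++ v.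
have pw' : pos w by move: pw; rewrite -rcons_cat all_rcons => /andP[].
have d0 : 0 < d by move: pw => /= /andP[].
have dw : all (dvdn d) w by rewrite all_cat dv all_nseq dvdnn orbT.
have dsw : d %| sumn w by elim: w dw {pw'} => //= a l IH /andP[da /IH]; apply: dvdn_add.
case: (boolP (d %| g)) => // ndg le8.
(* The 3-sums of 0, ..., 5 are 3, ..., 12. The new sums are not multiples of [d], while all old ones
   are. *)
have := @leq_nsums 4 (pts (rcons w g))
  (undup (ksums 4 (pts w)) ++ [seq sumn w + g + x | x <- [seq d * i | i <- iota 3 10]]).
rewrite size_cat !size_map size_iota -/(nsums4 (rcons w g)) -/(nsums 4 (pts w)) -/(nsums4 w).
move: le8; rewrite size_rcons => le8.
have sw : 5 <= size w by rewrite size_cat size_nseq leq_addr.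
have := nsums4_lower pw' (leq_trans _ sw) => /(_ isT) low H.
(* By the lower bound for [w], tightness of the longer word leaves room for at most seven new
   sums. *)
suff : nsums4 w + 10 <= nsums4 (rcons w g) by lia.
apply: H => [|x].
  rewrite cat_uniq undup_uniq -map_comp map_inj_uniq ?iota_uniq ?andbT; last first.
    by move=> i j /addnI/eqP; rewrite eqn_pmul2l // => /eqP.
  apply/hasPn => _ /mapP[i _ ->]; rewrite mem_undup; apply/negP => /(dvdn_ksums (dvdn_pts dw)).
  by rewrite /= -addnA dvdn_addr // dvdn_addl ?dvdn_mulr // (negPf ndg).
rewrite mem_cat mem_undup pts_rcons -cats1 => /orP[|/mapP[y]].
  exact/ksums_subseq/prefix_subseq.
move=> yB ->; rewrite cats1; apply: mem_ksums_rcons.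
apply: (@ksums_subseq _ (pts (nseq 5 d))).
  by rewrite -(take_pts _ v) take_subseq.
case/mapP: yB => i iB ->; rewrite pts_nseq.
have -> : [seq d * j | j <- iota 0 6] = [seq 0 + d * j | j <- iota 0 6] by [].
rewrite ksums_affine; apply/mapP; exists i; last by rewrite muln0.
by apply/(allP (a := fun i => i \in ksums 3 (iota 0 6)) _ i iB).
Qed.

(** Gaps to the right of the run are treated one at a time; those to the left follow by reversing
    the word. *)
Lemma tight_all_dvdn d u v :
  pos (u ++ nseq 5 d ++ v) -> tight (u ++ nseq 5 d ++ v) ->
  all (dvdn d) (u ++ nseq 5 d ++ v).
Proof.
have right z : pos (nseq 5 d ++ z) -> tight (nseq 5 d ++ z) -> all (dvdn d) z.
  elim/last_ind: z => // z g IH pz tz; rewrite all_rcons.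
  have dz : all (dvdn d) z.
    have [pz' tz'] : pos ((nseq 5 d ++ z) ++ [:: g]) /\ tight ((nseq 5 d ++ z) ++ [:: g]).
      by rewrite -catA cats1.
    apply: IH; last exact: tight_prefix tz'.
    by move: pz'; rewrite all_cat => /andP[].
  by rewrite dz (tight_gap_dvdn pz dz tz).
move=> pw tw; rewrite !all_cat all_nseq dvdnn orbT (right v) ?andbT.
- rewrite -all_rev; apply: right.
    by move: pw; rewrite catA all_cat -[all _ (u ++ _)]all_rev rev_cat rev_nseq => /andP[].
  rewrite -(rev_nseq 5) -rev_cat tight_rev; apply: (tight_prefix (z := v)); rewrite -?catA //.
  by rewrite size_cat size_nseq; lia.
- by move: pw; rewrite all_cat => /andP[].
by apply: tight_suffix tw.
Qed.

(** * Exhaustive search for tight words around a run of unit gaps *)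

(* If the next gap is at least 5, the sums of the new point with the 3-sums
   counted here exceed all old 4-sums; the bound covers all such gaps at once. *)
Definition far_gap_excluded w :=
  4 * (size w).+1 - 8 <
  count id (bsums 4 (pts w)) +
  count id (drop (size (bsums 4 (pts w)) - (sumn w + 5)) (bsums 3 (pts w))).

Lemma far_gap_excludedP w g :
  far_gap_excluded w -> tight (rcons w g) -> g < 5.
Proof.
rewrite /far_gap_excluded /tight size_rcons -nsumsE -count_drop_bsums -/(nsums4 w) => big tw.
rewrite ltnNge; apply/negP => g5.
have := @leq_nsums 4 (pts (rcons w g)) (undup (ksums 4 (pts w)) ++
  [seq sumn w + g + x | x <- [seq x <- undup (ksums 3 (pts w))
     | size (bsums 4 (pts w)) - (sumn w + 5) <= x]]).
rewrite size_cat size_map -/(nsums 4 (pts w)) -/(nsums4 w) -/(nsums4 (rcons w g)) => H.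
suff le_ : nsums4 w + size [seq x <- undup (ksums 3 (pts w))
     | size (bsums 4 (pts w)) - (sumn w + 5) <= x] <= nsums4 (rcons w g) by lia.
apply: H => [|x].
  rewrite cat_uniq undup_uniq /= map_inj_uniq ?filter_uniq ?undup_uniq ?andbT //; last exact: addnI.
  apply/hasPn => y /mapP[i]; rewrite mem_filter => /andP[le_i _] ->.
  by rewrite mem_undup; apply/negP => /ltn_size_bsums; lia.
rewrite mem_cat mem_undup pts_rcons -cats1 => /orP[|/mapP[y]].
  exact/ksums_subseq/prefix_subseq.
rewrite mem_filter mem_undup => /andP[_ yK] ->; rewrite cats1.
exact: mem_ksums_rcons.
Qed.

(** Larger gaps are ruled out by [far_gap_excluded]. The filter is [tight], phrased with [bsums] so
    that it computes. *)
Definition grow (L : seq (seq nat)) : seq (seq nat) :=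
  [seq w <- [seq rcons w g | w <- L, g <- iota 1 4]
     | count id (bsums 4 (pts w)) + 8 <= 4 * size w].

(** The continuation [k] receives the final list, so that a second search, on the reversed words,
    can be chained to the first. *)
Fixpoint search (n : nat) (k : seq (seq nat) -> bool) (L : seq (seq nat)) : bool :=
  if n is n'.+1 then all far_gap_excluded L && search n' k (grow L) else k L.

(** Prefixes of a tight word are tight, so every level of the search retains the relevant prefix of
    [w ++ v]. *)
Lemma searchP v w k L :
  search (size v) k L -> w \in L -> pos (w ++ v) -> 3 <= size w ->
  tight (w ++ v) -> exists2 L', k L' & w ++ v \in L'.
Proof.
elim: v w L => [|g v IH] w L /=; first by rewrite cats0; exists L.
move=> /andP[/allP far sL] wL; rewrite -cat_rcons => pw w3 tw.
have w3' : 3 <= size (rcons w g) by rewrite size_rcons ltnW.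
apply: (IH _ _ sL _ pw w3' tw).
have tg := tight_prefix pw w3' tw.
rewrite mem_filter -nsumsE -/(nsums4 _) -/(tight _) tg; apply/allpairsP.
exists (w, g); split=> //; rewrite [_.2]/=.
rewrite mem_iota (far_gap_excludedP (far _ wL) tg) andbT.
by move: pw; rewrite all_cat all_rcons => /andP[/andP[]].
Qed.

(* Initial gaps, read from the end of the set inwards, with excess at most 3. *)
Definition ends : seq (seq nat) :=
  [:: [:: 1; 1; 1; 1]; [:: 1; 1; 1; 2]; [:: 1; 1; 2; 1]; [:: 1; 2; 1; 1];
      [:: 2; 1; 1; 1]; [:: 2; 2; 1; 1]; [:: 3; 1; 1; 1]; [:: 4; 1; 1; 1]].

Definition regular w :=
  [&& take 4 w \in ends, drop 4 (take 11 w) == nseq 7 1 & rev (drop 11 w) \in ends].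

(** Here [i] counts the gaps to the left of the run of five ones: [10 - i] gaps are added on the
    right, then, after reversal, [i] on the left, for 15 gaps in all. *)
Lemma search_regular :
  all (fun i => search (10 - i)
    (fun L => search i (all (fun w => regular (rev w))) (map rev L)) [:: nseq 5 1])
    [:: 0; 3; 6; 9].
Proof. by vm_compute. Qed.

Lemma regular_extension a b :
  size a \in [:: 0; 3; 6; 9] -> size a + size b = 10 ->
  pos (a ++ nseq 5 1 ++ b) -> tight (a ++ nseq 5 1 ++ b) ->
  regular (a ++ nseq 5 1 ++ b).
Proof.
move=> sa sab pw tw; have := allP search_regular _ sa.
have -> : 10 - size a = size b by lia.
move=> /searchP/(_ (mem_head _ _)) [] //.
- by move: pw; rewrite all_cat => /andP[].
- by apply: tight_suffix tw.
move=> L; rewrite -(size_rev a) => /searchP H bL.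
have [||||L' /allP rL' ?] := H (rev (nseq 5 1 ++ b)).
- exact: map_f.
- by rewrite -rev_cat all_rev.
- by rewrite size_rev size_cat size_nseq.
- by rewrite -rev_cat tight_rev.
by rewrite -[_ ++ _]revK; apply: rL'; rewrite rev_cat.
Qed.

(** * From windows of sixteen points to the whole set *)

Lemma window_regular u : size u = 15 -> pos u -> tight u ->
  (forall a d b, u = a ++ nseq 5 d ++ b -> d = 1) -> regular u.
Proof.
move=> u15 pu tu prog.
(* A seven-point block with the minimal 13 sums contains a run of five equal gaps, which are 1 by
   hypothesis; the search then applies. *)
have finish i : i \in [:: 0; 3; 6; 9] -> nsums4 (take 6 (drop i u)) <= 13 -> regular u.
  move=> i_in; have le_i : i <= 9 by move: i_in; rewrite !inE; lia.
  have : size (take 6 (drop i u)) = 6 by rewrite size_take size_drop u15; case: ltnP; lia.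
  have : u = take i u ++ take 6 (drop i u) ++ drop 6 (drop i u) by rewrite !cat_take_drop.
  case: (take 6 _) => [|s [|c [|d [|e [|f [|g []]]]]]] // Eu _ le13.
  have pm : pos [:: s; c; d; e; f; g] by move: pu; rewrite Eu !all_cat => /and3P[].
  have E : u = take i u ++ nseq 5 s ++ (g :: drop 6 (drop i u)).
    by rewrite -(seven_points_progression pm le13).
  have s1 := prog _ _ _ E; rewrite s1 in E; rewrite [u in regular u]E.
  have si : size (take i u) = i by rewrite size_takel // u15; lia.
  apply: regular_extension; rewrite -?E ?si //.
  by rewrite /= !size_drop; lia.
move: {prog} u15 tu pu finish.
do 15![case: u => [|? u] //]; case: u => // _.
set u := [:: _; _; _; _; _; _; _; _; _; _; _; _; _; _; _] => tu pu finish.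
have p1 : pos (drop 3 u) by move: pu => /=; lia.
have p2 : pos (drop 6 u) by move: pu => /=; lia.
have := @nsums4_glue (take 3 u) (take 3 (drop 3 u)) (drop 6 u) pu erefl.
have := @nsums4_glue (take 3 (drop 3 u)) (take 3 (drop 6 u)) (drop 9 u) p1 erefl.
have := @nsums4_glue (take 3 (drop 6 u)) (take 3 (drop 9 u)) (drop 12 u) p2 erefl.
move=> g3 g2 g1.
have [le13|b0] := leqP (nsums4 (take 6 (drop 0 u))) 13; first exact: (finish 0 isT le13).
have [le13|b3] := leqP (nsums4 (take 6 (drop 3 u))) 13; first exact: (finish 3 isT le13).
have [le13|b6] := leqP (nsums4 (take 6 (drop 6 u))) 13; first exact: (finish 6 isT le13).
have [le13|b9] := leqP (nsums4 (take 6 (drop 9 u))) 13; first exact: (finish 9 isT le13).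
(* Four blocks with at least 14 sums each would give at least 4 * 14 - 3 = 53 sums, but a tight word
   of 15 gaps has at most 52. *)
move: b0 b3 b6 b9 g3 g2 g1 tu; rewrite /tight /= -/u.
by do 7![move: (nsums4 _) => ?]; lia.
Qed.

(* The exceptional gaps lie among the first four and the last four: every other
   gap is in the middle of some window of 16 points. *)
Lemma tight_shape G : pos G -> 15 <= size G -> tight G ->
  (forall d, all (dvdn d) G -> d = 1) ->
  exists p s : seq nat, [/\ p \in ends, s \in ends & G = p ++ nseq (size G - 8) 1 ++ rev s].
Proof.
move=> pG le15 tG gcdG.
have win j : j + 15 <= size G -> regular (take 15 (drop j G)).
  move=> le_j; pose u := take j G; pose z := drop 15 (drop j G).
  have EG : G = u ++ take 15 (drop j G) ++ z by rewrite !cat_take_drop.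
  have sw : size (take 15 (drop j G)) = 15 by rewrite size_takel // size_drop; lia.
  have := pG; rewrite {1}EG !all_cat => /and3P[pu pw pz].
  apply: window_regular => // [|a d b Ew].
    apply: (tight_suffix (u := u)); rewrite ?all_cat ?pu ?sw //.
    apply: (tight_prefix (z := z)); rewrite -?catA -?EG //.
    by rewrite size_cat sw; lia.
  have EG' : G = (u ++ a) ++ nseq 5 d ++ (b ++ z) by rewrite {1}EG Ew !catA.
  by apply: gcdG; rewrite EG'; apply: tight_all_dvdn; rewrite -EG'.
exists (take 4 G), (rev (drop (size G - 4) G)); split.
- have /and3P[] := win 0 le15; rewrite drop0 => + _ _.
  by rewrite take_takel.
- have /win/and3P[_ _] : size G - 15 + 15 <= size G by lia.
  rewrite [take 15 _]take_oversize; last by rewrite size_drop; lia.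
  by rewrite drop_drop; have -> : 11 + (size G - 15) = size G - 4 by lia.
rewrite revK -{1}(cat_take_drop (size G - 4) G) -{1}(cat_take_drop 4 (take _ G)).
rewrite -catA take_takel; last lia.
congr (_ ++ _ ++ _).
have sz : size (drop 4 (take (size G - 4) G)) = size G - 8.
  by rewrite size_drop size_takel; lia.
apply: (@eq_from_nth _ 0); rewrite sz ?size_nseq // => i lt_i.
rewrite nth_nseq lt_i nth_drop nth_take; last lia.
(* The window starting at gap [i], or the last window if that one does not fit, has gap [4 + i]
   among its seven middle gaps. *)
have /win/and3P[_ /eqP mid _] : minn i (size G - 15) + 15 <= size G by lia.
have := congr1 (fun l => nth 0 l (i - minn i (size G - 15))) mid.
rewrite nth_nseq ifT; last lia.
rewrite nth_drop !nth_take ?nth_drop; try lia.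
have -> // : minn i (size G - 15) + (4 + (i - minn i (size G - 15))) = 4 + i by lia.
Qed.

(** * Bounds on the two ends and the extremal pairs *)

Lemma nsums4_ends p s n : pos p -> pos s -> 7 <= n ->
  nsums4 (p ++ nseq 5 1) + nsums4 (s ++ nseq 5 1) + 4 * (n - 7) <=
    (nsums4 (p ++ nseq n 1 ++ rev s)).+1.
Proof.
move=> pp ps le7; have [m ->] : exists m, n = m + 7 by exists (n - 7); lia.
have p1 k : pos (nseq k 1) by rewrite all_nseq orbT.
have En a b : nseq (a + b) 1 = nseq a 1 ++ nseq b 1 by rewrite nseqD.
(* The word is covered by [p] with five ones, a block of [3 + m] ones, and five ones with [rev s];
   neighbouring blocks share three ones. *)
have := @nsums4_glue (p ++ nseq (m + 2) 1) (nseq 3 1) (nseq 2 1 ++ rev s).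
have := @nsums4_glue (p ++ nseq 2 1) (nseq 3 1) (nseq m 1).
have := @nsums4_lower (nseq (3 + m) 1).
rewrite -(nsums4_rev (s ++ _)) rev_cat rev_nseq.
rewrite !catA -!En -!(catA p) -!En !all_cat !p1 all_rev pp ps !size_nseq.
have -> : m + 2 + 3 + 2 = m + 7 by lia.
have -> : m + 2 + 3 = 2 + 3 + m by lia.
move=> /(_ isT isT) low /(_ isT erefl) g1 /(_ isT erefl) g2.
rewrite -[2 + 3]/5 -[3 + 2]/5 in g1 g2 *.
lia.
Qed.

(** All sums lie between those of the first four and of the last four points, so there are at most
    as many as integers in that range. *)
Lemma nsums4_upper u v z : pos (u ++ z ++ v) -> size u = 3 -> size v = 3 ->
  nsums4 (u ++ z ++ v) + sumn (pts u) <= (4 * (sumn u + sumn z) + sumn (pts v)).+1.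
Proof.
move=> pw u3 v3; have sw := sorted_pts pw.
set M := 4 * (sumn u + sumn z) + sumn (pts v).
have bounds x : x \in ksums 4 (pts (u ++ z ++ v)) -> sumn (pts u) <= x <= M.
  move=> xK; have := ksums_min sw xK; have := ksums_max sw xK.
  rewrite -{2}u3 take_pts => + ->; rewrite size_pts !size_cat v3 catA.
  have -> : (size u + (size z + 3)).+1 - 4 = size (u ++ z) by rewrite size_cat; lia.
  by rewrite drop_pts sumn_shift size_pts v3 sumn_cat.
have le_uM : sumn (pts u) <= M.
  have : sumn (take 4 (pts (u ++ z ++ v))) \in ksums 4 (pts (u ++ z ++ v)).
    apply/ksumsP; exists (take 4 (pts (u ++ z ++ v))).
    by rewrite take_subseq size_takel // size_pts !size_cat u3.
  by move=> /bounds/andP[/leq_trans le1 /le1].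
suff : nsums4 (u ++ z ++ v) <= size (iota (sumn (pts u)) (M.+1 - sumn (pts u))).
  by rewrite size_iota; lia.
apply: uniq_leq_size (undup_uniq _) _ => x; rewrite mem_undup => /bounds.
by rewrite mem_iota; lia.
Qed.

(** Both ends are read inwards; the pairs are listed in the order of the twelve sets of the
    theorem. *)
Definition extremal : seq (seq nat * seq nat) :=
  [:: ([:: 4; 1; 1; 1], [:: 1; 1; 1; 1]); ([:: 1; 1; 1; 1], [:: 4; 1; 1; 1]);
      ([:: 3; 1; 1; 1], [:: 2; 1; 1; 1]); ([:: 2; 1; 1; 1], [:: 3; 1; 1; 1]);
      ([:: 2; 2; 1; 1], [:: 1; 1; 1; 1]); ([:: 1; 1; 1; 1], [:: 2; 2; 1; 1]);
      ([:: 1; 2; 1; 1], [:: 2; 1; 1; 1]); ([:: 2; 1; 1; 1], [:: 1; 2; 1; 1]);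
      ([:: 1; 1; 2; 1], [:: 1; 1; 1; 1]); ([:: 1; 1; 1; 1], [:: 1; 1; 2; 1]);
      ([:: 1; 1; 1; 2], [:: 1; 1; 1; 1]); ([:: 1; 1; 1; 1], [:: 1; 1; 1; 2])].

(* A 10-point end has at least 25 sums, so 53 = 2 * 25 + 3 bounds the total excess
   of the two ends by 3; the second condition says that [4k - 12] sums fit
   between the smallest and the largest one. *)
Lemma extremal_ends :
  all (fun p => all (fun s =>
    (count id (bsums 4 (pts (p ++ nseq 5 1))) +
       count id (bsums 4 (pts (s ++ nseq 5 1))) <= 53) &&
    (24 + sumn (pts (take 3 p)) + 4 * sumn (take 3 s) <=
       (4 * (sumn p + sumn s) + sumn (pts (rev (take 3 s)))).+1)
    ==> ((p, s) \in extremal)) ends) ends.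
Proof. by vm_compute. Qed.

Lemma extremal_shape G : pos G -> 15 <= size G -> nsums4 G + 8 = 4 * size G ->
  (forall d, all (dvdn d) G -> d = 1) ->
  exists p s : seq nat, (p, s) \in extremal /\ G = p ++ nseq (size G - 8) 1 ++ rev s.
Proof.
move=> pG le15 NG gcdG; have tG : tight G by rewrite /tight NG.
have [p [s [pE sE EG]]] := tight_shape pG le15 tG gcdG.
exists p, s; split=> //.
have := allP (allP extremal_ends _ pE) _ sE; move/implyP; apply.
have size4 (q : seq nat) : q \in ends -> size q = 4.
  by move=> qE; apply/eqP; apply: (allP (a := fun q => size q == 4)) q qE.
have := pG; rewrite {1}EG !all_cat all_rev => /and3P[pp _ ps].
rewrite -!nsumsE -/(nsums4 _) -/(nsums4 _); apply/andP; split.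
  have le7 : 7 <= size G - 8 by lia.
  by have := nsums4_ends pp ps le7; rewrite -EG; lia.
(* With [n] ones in the middle, [nsums4 G] is [4 * n + 24]; the term [4 * n] cancels, so the
   condition depends only on [p] and [s]. *)
have := @nsums4_upper (take 3 p) (rev (take 3 s))
  (drop 3 p ++ nseq (size G - 8) 1 ++ rev (drop 3 s)).
rewrite -!catA -rev_cat catA !cat_take_drop -EG size_rev !size_takel ?(size4 p pE) ?(size4 s sE) //.
move=> /(_ pG erefl erefl); rewrite !sumn_cat sumn_nseq sumn_rev.
have := congr1 sumn (cat_take_drop 3 p); have := congr1 sumn (cat_take_drop 3 s).
rewrite !sumn_cat; lia.
Qed.

(** * Transfer between gap words and finite sets of integers *)

Lemma mem_pts_cat u v x :
  (x \in pts (u ++ v)) = (x \in pts u) || (sumn u <= x) && (x - sumn u \in pts v).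
Proof.
have in_drop : (x \in drop (size u) (pts (u ++ v))) = (sumn u <= x) && (x - sumn u \in pts v).
  rewrite drop_pts; apply/mapP/andP => [[y yv ->]|[le_ux xv]].
    by rewrite leq_addr addKn.
  by exists (x - sumn u); rewrite ?subnKC.
rewrite -in_drop; apply/idP/orP => [|[]].
- rewrite -{1}(cat_take_drop (size u).+1 (pts (u ++ v))) mem_cat take_pts.
  case/orP=> [|xd]; [by left | right].
  by apply: (@mem_drop 1); rewrite drop_drop.
- by rewrite -(take_pts u v); apply: mem_take.
exact: mem_drop.
Qed.

Lemma sorted_wordP c l :
  path ltn c l -> exists2 w, pos w & c :: l = [seq c + x | x <- pts w].
Proof.
elim: l c => [|b l IH] c /=; first by exists [::]; rewrite //= addn0.
case/andP=> lt_cb /IH[w pw E]; exists (b - c :: w); first by rewrite /= subn_gt0 lt_cb.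
rewrite E /= addn0 -map_comp; congr (_ :: _); apply: eq_map => x /=.
by rewrite addnA subnKC // ltnW.
Qed.

Local Open Scope fset_scope.
Local Open Scope ring_scope.

Lemma sum_Posz (t : seq nat) : \sum_(x <- [seq Posz n | n <- t]) x = (sumn t)%:Z.
Proof. by rewrite big_map; elim: t => [|a t IH]; rewrite ?big_nil // big_cons IH. Qed.

(** All elements are nonnegative, so [absz] is injective on [A]; the sorted list of absolute values
    starts with 0, and its differences form the word. *)
Lemma fset_wordP (A : {fset int}) : is_fset_min A 0 ->
  exists2 w, pos w & perm_eq A [seq n%:Z | n <- pts w].
Proof.
move=> [A0 Amin].
have absA : {in A, cancel absz Posz} by move=> a /Amin a0; rewrite gez0_abs.
pose l := sort leq [seq absz a | a <- A].
have sl : sorted ltn l.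
  rewrite ltn_sorted_uniq_leq sort_uniq (sort_sorted leq_total) andbT.
  by rewrite map_inj_in_uniq ?fset_uniq //; apply: can_in_inj absA.
have pl : perm_eq A [seq n%:Z | n <- l].
  have -> : A = [seq n%:Z | n <- [seq absz a | a <- A]] :> seq int.
    by rewrite -map_comp -[LHS]map_id; apply/eq_in_map => a /absA /= ->.
  by apply: perm_map; rewrite perm_sym perm_sort.
have l0 : 0%N \in l by rewrite mem_sort; apply/mapP; exists 0.
case: l sl pl l0 => // b l sl pl l0.
have {}l0 : b = 0%N.
  move: l0; rewrite inE => /orP[/eqP->//|/(allP (order_path_min ltn_trans sl))].
  by [].
have [w pw E] := sorted_wordP sl; exists w => //.
by rewrite -[pts w]map_id; move: pl; rewrite E l0.
Qed.

(** Subsets of [A] correspond to subsequences of [pts w], by filtering in one direction and taking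
    images in the other. *)
Lemma card_restricted_sumset h (A : {fset int}) (w : seq nat) : pos w ->
  perm_eq A [seq n%:Z | n <- pts w] -> #|` restricted_sumset h A| = nsums h (pts w).
Proof.
move=> pw pA; have uw := sorted_uniq ltn_trans ltnn (sorted_pts pw).
have memA n : (n%:Z \in A) = (n \in pts w).
  by rewrite (perm_mem pA) mem_map // => ? ? [].
rewrite /nsums -(size_map Posz); apply/perm_size/uniq_perm.
- exact: fset_uniq.
- by rewrite map_inj_uniq ?undup_uniq // => ? ? [].
move=> x; apply/restricted_sumsetP/mapP => [[B [BA Bh ->]]|[n]].
  pose t := [seq n <- pts w | n%:Z \in B].
  have tB : perm_eq B [seq n%:Z | n <- t].
    apply: uniq_perm; rewrite ?fset_uniq // ?map_inj_uniq ?filter_uniq //; first by move=> ? ? [].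
    move=> b; apply/idP/mapP => [bB|[n]]; last by rewrite mem_filter => /andP[? _] ->.
    have := fsubsetP BA _ bB; rewrite (perm_mem pA) => /mapP[n nw Eb].
    by exists n => //; rewrite mem_filter nw -Eb bB.
  exists (sumn t); last by rewrite (perm_big _ tB) sum_Posz.
  rewrite mem_undup; apply/ksumsP; exists t; split=> //; first exact: filter_subseq.
  by rewrite -Bh (perm_size tB) size_map.
rewrite mem_undup => /ksumsP[t [tw th <-]] ->.
have ut := subseq_uniq tw uw.
exists [fset y in [seq n%:Z | n <- t]].
have tB : perm_eq [fset y in [seq n%:Z | n <- t]] [seq n%:Z | n <- t].
  apply: uniq_perm; rewrite ?fset_uniq // ?map_inj_uniq //; first by move=> ? ? [].
  by move=> y; rewrite in_fset.
split.
- apply/fsubsetP => y; rewrite in_fset => /mapP[m mt ->].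
  by rewrite memA (mem_subseq tw).
- by rewrite -th -(size_map Posz) (perm_size tB).
by rewrite (perm_big _ tB) sum_Posz.
Qed.

Lemma fset_gcd1_dvdn (A : {fset int}) (w : seq nat) :
  fset_gcd A = 1 -> perm_eq A [seq n%:Z | n <- pts w] ->
  forall d : nat, all (dvdn d) w -> d = 1%N.
Proof.
move=> gA pA d /dvdn_pts/allP dw; apply/eqP; rewrite -dvdn1.
suff : (d%:Z %| fset_gcd A)%Z by rewrite gA.
rewrite /fset_gcd big_seq.
elim/big_ind: _ => [|x y dx dy|x]; rewrite ?dvdz0 // ?dvdz_gcd ?dx //.
by rewrite (perm_mem pA) => /mapP[n /dw dn ->].
Qed.

Lemma mem_pts_ones n x : (x \in pts (nseq n 1%N)) = (x <= n)%N.
Proof.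
rewrite pts_nseq (eq_map (g := id)) ?map_id ?mem_iota ?ltnS //.
by move=> i; rewrite mul1n.
Qed.

(** Reduces an equality of sets to a membership criterion on naturals that linear arithmetic can
    settle. *)
Lemma interval_minusE (A : {fset int}) (w : seq nat) (b x y z : int) :
  perm_eq A [seq n%:Z | n <- pts w] ->
  (forall n : nat, (n \in pts w) =
     [&& n%:Z <= b, n%:Z != x, n%:Z != y & n%:Z != z]) ->
  A = (int_interval 0 b `\` [fset x; y; z]).
Proof.
move=> pA pwE; apply/fsetP => t; rewrite (perm_mem pA) !inE in_int_interval.
apply/mapP/idP => [[n]|].
  by rewrite pwE => /and4P[nb /negPf nx /negPf ny /negPf nz] ->; rewrite nx ny nz nb.
rewrite !negb_or => /andP[/andP[/andP[tx ty] tz] /andP[t0 tb]].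
have Et : t = (absz t)%:Z by rewrite gez0_abs.
by exists (absz t) => //; rewrite pwE -Et tb tx ty.
Qed.


(** * Reading off the twelve sets *)

Theorem theorem1p14 (k : nat) (A : {fset int})
  (k_ge16 : (16 <= k)%N)
  (cardA : #|` A| = k)
  (minA : is_fset_min A 0)
  (gcdA : fset_gcd A = 1)
  (card4A : #|` restricted_sumset 4 A| = (4 * k - 12)%N) :
  let K : int := k%:Z in
  exists x y z : int,
    A = int_interval 0 (K + 2) `\` [fset x; y; z] /\
    [fset x; y; z] \in
      [:: [fset 1; 2; 3];
          [fset K - 1; K; K + 1];
          [fset 1; 2; K + 1];
          [fset 1; K; K + 1];
          [fset 1; 3; K + 2];
          [fset K - 2; K; K + 2];
          [fset 2; K; K + 2];
          [fset 1; K - 1; K + 2];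
          [fset 3; K + 1; K + 2];
          [fset K - 3; K + 1; K + 2];
          [fset 4; K + 1; K + 2];
          [fset K - 4; K + 1; K + 2]].
Proof.
move=> K; have [w pw pA] := fset_wordP minA.
have sw : (size w).+1 = k by rewrite -cardA (perm_size pA) size_map size_pts.
have Nw : (nsums4 w + 8 = 4 * size w)%N.
  by rewrite /nsums4 -(card_restricted_sumset 4 pw pA) card4A; lia.
have [|p [s [ps Ew]]] := extremal_shape pw _ Nw (fset_gcd1_dvdn gcdA pA); first by lia.
have EK : K = (size w - 8)%:Z + 9 by rewrite /K; lia.
have K16 : 16 <= K by [].
(* From here on only the number [n] of middle ones and the relation [K = n + 9] matter. *)
clearbody K; move: (size w - 8)%N Ew EK => n Ew EK.
have mem_w i : (i \in pts w) = (i \in pts p) || (sumn p <= i)%N &&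
    ((i - sumn p <= n) || (n <= i - sumn p) && (i - sumn p - n \in pts (rev s)))%N.
  by rewrite Ew !mem_pts_cat mem_pts_ones sumn_nseq mul1n.
move: ps mem_w {Ew Nw pw sw}; rewrite /extremal.
(* In each case the removed points are those skipped by gaps above 1, together with the points of
   the interval beyond the maximum of [A]. *)
rewrite in_cons => /predU1P[[-> ->] mem_w|].
  exists 1, 2, 3; split; last by rewrite !in_cons eqxx ?orbT.
  by apply: interval_minusE pA _ => i; rewrite mem_w /= !inE; lia.
rewrite in_cons => /predU1P[[-> ->] mem_w|].
  exists (K - 1), K, (K + 1); split; last by rewrite !in_cons eqxx ?orbT.
  by apply: interval_minusE pA _ => i; rewrite mem_w /= !inE; lia.
rewrite in_cons => /predU1P[[-> ->] mem_w|].
  exists 1, 2, (K + 1); split; last by rewrite !in_cons eqxx ?orbT.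
  by apply: interval_minusE pA _ => i; rewrite mem_w /= !inE; lia.
rewrite in_cons => /predU1P[[-> ->] mem_w|].
  exists 1, K, (K + 1); split; last by rewrite !in_cons eqxx ?orbT.
  by apply: interval_minusE pA _ => i; rewrite mem_w /= !inE; lia.
rewrite in_cons => /predU1P[[-> ->] mem_w|].
  exists 1, 3, (K + 2); split; last by rewrite !in_cons eqxx ?orbT.
  by apply: interval_minusE pA _ => i; rewrite mem_w /= !inE; lia.
rewrite in_cons => /predU1P[[-> ->] mem_w|].
  exists (K - 2), K, (K + 2); split; last by rewrite !in_cons eqxx ?orbT.
  by apply: interval_minusE pA _ => i; rewrite mem_w /= !inE; lia.
rewrite in_cons => /predU1P[[-> ->] mem_w|].
  exists 2, K, (K + 2); split; last by rewrite !in_cons eqxx ?orbT.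
  by apply: interval_minusE pA _ => i; rewrite mem_w /= !inE; lia.
rewrite in_cons => /predU1P[[-> ->] mem_w|].
  exists 1, (K - 1), (K + 2); split; last by rewrite !in_cons eqxx ?orbT.
  by apply: interval_minusE pA _ => i; rewrite mem_w /= !inE; lia.
rewrite in_cons => /predU1P[[-> ->] mem_w|].
  exists 3, (K + 1), (K + 2); split; last by rewrite !in_cons eqxx ?orbT.
  by apply: interval_minusE pA _ => i; rewrite mem_w /= !inE; lia.
rewrite in_cons => /predU1P[[-> ->] mem_w|].
  exists (K - 3), (K + 1), (K + 2); split; last by rewrite !in_cons eqxx ?orbT.
  by apply: interval_minusE pA _ => i; rewrite mem_w /= !inE; lia.
rewrite in_cons => /predU1P[[-> ->] mem_w|].
  exists 4, (K + 1), (K + 2); split; last by rewrite !in_cons eqxx ?orbT.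
  by apply: interval_minusE pA _ => i; rewrite mem_w /= !inE; lia.
rewrite mem_seq1 => /eqP[-> ->] mem_w.
exists (K - 4), (K + 1), (K + 2); split; last by rewrite !in_cons eqxx ?orbT.
by apply: interval_minusE pA _ => i; rewrite mem_w /= !inE; lia.
Qed.
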